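(* Let $g$ be a smooth nonlinear function and consider a nonlinear conservative full-order model (FOM) $$\dot q=p,\qquad \dot p=Dq-f_{\mathrm{non}}(q),\qquad q(t),p(t)\in\mathbb{R}^n,\quad D=D^\top\in\mathbb{R}^{n\times n},$$ obtained by spatial discretization of a conservative wave equation $\partial_t^2\phi=\Delta\phi-f_{\mathrm{non}}(\phi)$, where $f_{\mathrm{non}}$ is the derivative of $g$, applied entrywise to $q$. The FOM conserves the energy $E(q,p)=\tfrac12p^\top p-\tfrac12q^\top Dq+\sum_{i=1}^n g(q_i)$. Suppose that the following two assumptions hold. (Assumption 1) The nonlinear potential energy component $g(q)$ is nonnegative. (Assumption 2) For nonlinear conservative PDEs with non-polynomial nonlinearities in $g(q)$, the energy-quadratization strategy (Steps 1–3 in the context) yields a quadratization of the nonlinear dynamics of the FOM. Then the energy-quadratization strategy (Steps 1–3) combined with POD model reduction (Steps 4–5 in the context) yields quadratic reduced-order models (ROMs) that conserve the lifted FOM energy $E_{\mathrm{lift}}$ defined in the context, i.e. $$\frac{d}{dt}\Big(E_{\mathrm{lift}}(\bar V\bar y_r)\Big)=0,$$ where $\bar V$ is the block-diagonal basis matrix of Step 4 and $\bar y_r=(\hat q,\hat p,\hat w_1,\dots,\hat w_k)$ is the reduced state.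
   Context: Notation: $\odot$ is the componentwise (Hadamard) product of vectors; scalar functions and quotients of vectors are taken entrywise. Quadratization. For an ODE system $\dot y=f(y)$, a finite-dimensional vector of new variables $w=w(y)$ is a quadratization if there are vectors of polynomials $\bar f(y,w)$ and $\bar f_{\mathrm{aux}}(y,w)$, with all entries of total degree at most two, such that $\dot y=\bar f(y,w)$ and $\dot w=\bar f_{\mathrm{aux}}(y,w)$ for each $y$ solving $\dot y=f(y)$. Here $y=(q,p)$. Energy-quadratization strategy and model reduction. Step 1. Define an auxiliary variable that transforms the nonlinear FOM energy into a quadratic energy in the augmented variables: the first auxiliary variable $w_1$ is defined by $w_1\odot w_1=\kappa^2 g(q)$, where $\kappa\in\mathbb{R}$ is a free nonzero scalar parameter. Thus $\sum_{i=1}^n g(q_i)=\frac{1}{\kappa^2}w_1^\top w_1$. Step 2. Compute the evolution equation of $w_1$. If the time evolution equations of $q,p,w_1$ are not quadratic in terms of $q,p,w_1$, introduce the second auxiliary variable $w_2=\frac{f_{\mathrm{non}}(q)}{\bar\kappa\,w_1}$, with another free nonzero scalar parameter $\bar\kappa\in\mathbb{R}$. Thus $f_{\mathrm{non}}(q)=\bar\kappa\,w_1\odot w_2$. Step 3. Compute the evolution equation of the second auxiliary variable. If it is nonlinear, introduce additional auxiliary variable(s) so that the dynamics of the lifted system, including the evolution equations of all auxiliary variables, are quadratic. The auxiliary variables $w_1,\dots,w_k\in\mathbb{R}^n$ are functions of $q$ only. Lifted FOM. The resulting quadratic system is the lifted FOM; with $w_1$ and $w_2$ both present it is written as $$\dot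 q=p,\quad \dot p=Dq-\bar\kappa\,w_1\odot w_2,\quad \dot w_1=\tfrac{\kappa^2\bar\kappa}{2}\,w_2\odot p,\quad \dot w_i=\Big(\alpha_i q+\sum_{j=1}^k\alpha_{i,j}w_j\Big)\odot p\quad(i=2,\dots,k),$$ where $\alpha_i$ and $\alpha_{i,1},\dots,\alpha_{i,k}$ are real constants which, for each $i=2,\dots,k$, are not all zero. Lifted FOM energy. The lifted FOM possesses the quadratic invariant $$E_{\mathrm{lift}}(q,p,w_1,\dots,w_k)=\tfrac12p^\top p-\tfrac12q^\top Dq+\tfrac1{\kappa^2}w_1^\top w_1 .$$ Step 4. Choose a basis that preserves the coupling structure of the lifted FOM: $\bar V=\mathrm{blkdiag}(\Phi,\Phi,V_1,\dots,V_k)$. Here, from FOM snapshot matrices $Q=[q_1,\dots,q_K]$ and $P=[p_1,\dots,p_K]$ in $\mathbb{R}^{n\times K}$, $\Phi\in\mathbb{R}^{n\times r}$ is computed by the cotangent lift algorithm, i.e. its columns are leading left singular vectors of $[Q,P]$; and $V_i$ is the POD basis matrix for $w_i$, i.e. its columns are leading left singular vectors of the lifted snapshot matrix $W_i=[w_i(q_1),\dots,w_i(q_K)]$, obtained by applying the lifting transformation to the FOM snapshots. In particular $\Phi^\top\Phi=I$ and $V_i^\top V_i=I$. Step 5. Project the lifted FOM onto the reduced subspace (POD–Galerkin projection with $q\approx\Phi\hat q$, $p\approx\Phi\hat p$, $w_i\approx V_i\hat w_i$). For the lifted FOM displayed above, this gives the quadratic ROM $$\dot{\hat q}=\hat p,\quad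 \dot{\hat p}=\Phi^\top D\Phi\,\hat q-\bar\kappa\,\Phi^\top(V_1\hat w_1\odot V_2\hat w_2),\quad \dot{\hat w}_1=\tfrac{\kappa^2\bar\kappa}{2}V_1^\top(V_2\hat w_2\odot\Phi\hat p),$$ $$\dot{\hat w}_i=V_i^\top\Big(\Big(\alpha_i\Phi\hat q+\sum_{j=1}^k\alpha_{i,j}V_j\hat w_j\Big)\odot\Phi\hat p\Big)\quad(i=2,\dots,k).$$ *)

(* Defs.v *)
From HB Require Import structures.
From mathcomp Require Import all_boot all_order all_algebra.
From mathcomp Require Import all_classical all_reals all_analysis.
From mathcomp Require mpoly.
Import (canonicals, coercions) mpoly.

Set Implicit Arguments.
Unset Strict Implicit.
Unset Printing Implicit Defensive.
Import Order.TTheory GRing.Theory Num.Theory.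
Import numFieldNormedType.Exports.
Local Open Scope classical_set_scope.
Local Open Scope ring_scope.

Notation hadamard := (map2_mx *%R).

Section Calculus.
Variable R : realType.

Definition smooth (g : R -> R) : Prop :=
  forall m x, derivable (derive1n m g) x 1.

(* Only maps x |-> a * x are excluded: this is the weakest reading. *)
Definition nonlinear (g : R -> R) : Prop := ~ exists a, forall x, g x = a * x.

Definition non_polynomial (g : R -> R) : Prop :=
  ~ exists p : {poly R}, forall x, g x = p.[x].

Definition solves m (F : 'cV[R]_m -> 'cV[R]_m) (J : set R) (y : R -> 'cV[R]_m)
    : Prop :=
  forall t, J t -> is_derive t (1 : R) y (F (y t)).

(* [msize] is the total degree plus one. *)
Definition quadratic_map m l (F : 'cV[R]_m -> 'cV[R]_l) : Prop :=
  exists P : 'I_l -> mpoly.mpoly m R,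
    (forall a, mpoly.mmeasure (@mpoly.mdeg m) (P a) <= 3)%N /\
    (forall x a, F x a 0 = mpoly.meval (fun b => x b 0) (P a)).

(* The new variables [w] quadratize y' = f(y), and F stacks the vectors of
   polynomials giving y' and w(y)' in terms of (y, w(y)). *)
Definition quadratization m l (f : 'cV[R]_m -> 'cV[R]_m)
    (w : 'cV[R]_m -> 'cV[R]_l) (F : 'cV[R]_(m + l) -> 'cV[R]_(m + l)) : Prop :=
  quadratic_map F /\
  forall (J : set R) y, open J -> solves f J y ->
    solves F J (fun t => col_mx (y t) (w (y t))).

End Calculus.

Section Lifting.
Variables (R : realType) (n k : nat).
Implicit Types (D : 'M[R]_n) (q p : 'cV[R]_n) (w : 'I_k.+1 -> 'cV[R]_n).

Definition fom D (fnon : R -> R) (y : 'cV[R]_(n + n)) : 'cV[R]_(n + n) :=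
  let q := usubmx y in let p := dsubmx y in
  col_mx p (D *m q - map_mx fnon q).

(* There are k + 1 auxiliary variables per grid point, numbered from 0.
   The entries of [alpha] and [alphaw] at index 0, and [alpha0], are used only
   if k = 0, see [second_factor]. *)
Record coefs := Coefs {
  kappa : R;
  kappab : R;
  alpha0 : R;
  alpha : 'I_k.+1 -> R;
  alphaw : 'M[R]_k.+1 }.

Implicit Type c : coefs.

Definition affine_term c (i : 'I_k.+1) q w : 'cV[R]_n :=
  alpha c i *: q + \sum_j alphaw c i j *: w j.

(* The factor s of the splitting fnon(q) = kappab * (w_1 . s): it is the second
   auxiliary variable when there is one.  When w_1 alone makes the equations
   quadratic no second variable is introduced, and s is itself an affine
   expression of q and w_1. *)
Definition second_factor c q w : 'cV[R]_n :=
  if insub 1%N is Some i2 then w i2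
  else const_mx (alpha0 c) + affine_term c ord0 q w.

Definition aux_rate c q p w (i : 'I_k.+1) : 'cV[R]_n :=
  if i == ord0
  then (kappa c ^+ 2 * kappab c / 2) *: hadamard (second_factor c q w) p
  else hadamard (affine_term c i q w) p.

(* Lifted states are stacked as (q, p, w_1, ..., w_{k+1}). *)
Definition lifted_fom D c (x : 'cV[R]_(n + n + \sum_(i < k.+1) n))
    : 'cV[R]_(n + n + \sum_(i < k.+1) n) :=
  let q := usubmx (usubmx x) in
  let p := dsubmx (usubmx x) in
  let w := submxcol (dsubmx x) in
  col_mx
    (col_mx p (D *m q - kappab c *: hadamard (w ord0) (second_factor c q w)))
    (\mxcol_(i < k.+1) aux_rate c q p w i).

Definition lifted_energy D c (x : 'cV[R]_(n + n + \sum_(i < k.+1) n)) : R :=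
  let q := usubmx (usubmx x) in
  let p := dsubmx (usubmx x) in
  let w1 := submxcol (dsubmx x) ord0 in
  (p^T *m p) 0 0 / 2 - (q^T *m D *m q) 0 0 / 2
  + (w1^T *m w1) 0 0 / kappa c ^+ 2.

Definition aux_vector (w : 'I_k.+1 -> 'cV[R]_n -> 'cV[R]_n)
    (y : 'cV[R]_(n + n)) : 'cV[R]_(\sum_(i < k.+1) n) :=
  \mxcol_(i < k.+1) w i (usubmx y).

(* The quotient fnon(q) / (kappab w_1) is imposed only at the entries where
   w_1 does not vanish; at the others g(q_a) = 0, so that g'(q_a) = 0 when g is
   nonnegative and fnon(q) = kappab * (w_1 . w_2) still holds. *)
Definition energy_variables (g fnon : R -> R) c
    (w : 'I_k.+1 -> 'cV[R]_n -> 'cV[R]_n) : Prop :=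
  [/\ kappa c != 0, kappab c != 0,
      forall q, hadamard (w ord0 q) (w ord0 q)
                = kappa c ^+ 2 *: map_mx g q,
      forall q a, w ord0 q a 0 != 0 ->
        second_factor c q (w^~ q) a 0
        = fnon (q a 0) / (kappab c * w ord0 q a 0)
    & forall i, i != ord0 -> alpha c i != 0 \/ exists j, alphaw c i j != 0].

End Lifting.

Arguments coefs : clear implicits.

Section Reduction.
Variable R : realType.

(* The columns of V are the first r left singular vectors of S, in an SVD
   S = U Sigma T^T with nonincreasing singular values. *)
Definition leading_left_singular n m r (S : 'M[R]_(n, m)) (V : 'M[R]_(n, r))
    : Prop :=
  exists (le_rn : (r <= n)%N) (U : 'M[R]_n) (Sigma : 'M[R]_(n, m))
         (T : 'M[R]_m),
    [/\ U^T *m U = 1%:M /\ T^T *m T = 1%:M,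
        is_diag_mx Sigma /\ (forall i j, 0 <= Sigma i j),
        forall (i i' : 'I_n) (j j' : 'I_m),
          i = j :> nat -> i' = j' :> nat -> (i <= i')%N ->
          Sigma i' j' <= Sigma i j,
        S = U *m Sigma *m T^T
      & V = colsub (widen_ord le_rn) U].

Definition aux_snapshots n K (w : 'cV[R]_n -> 'cV[R]_n) (Q : 'M[R]_(n, K))
    : 'M[R]_(n, K) :=
  \matrix_(a, j) w (col j Q) a 0.

Variables (n k r : nat) (rw : 'I_k.+1 -> nat).

Definition block_basis (Phi : 'M[R]_(n, r)) (V : forall i, 'M[R]_(n, rw i))
    : 'M[R]_(n + n + \sum_(i < k.+1) n, r + r + \sum_i rw i) :=
  block_mx (block_mx Phi 0 0 Phi) 0
           0 (\mxblock_(i < k.+1, j < k.+1) if i == j then V j else 0).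

Definition galerkin N M (V : 'M[R]_(N, M)) (F : 'cV[R]_N -> 'cV[R]_N)
    (z : 'cV[R]_M) : 'cV[R]_M :=
  V^T *m F (V *m z).

Definition rom (D : 'M[R]_n) (c : coefs R k) (Phi : 'M[R]_(n, r))
    (V : forall i, 'M[R]_(n, rw i)) (z : 'cV[R]_(r + r + \sum_i rw i))
    : 'cV[R]_(r + r + \sum_i rw i) :=
  let qh := usubmx (usubmx z) in
  let ph := dsubmx (usubmx z) in
  let w := fun i => V i *m submxcol (dsubmx z) i in
  col_mx
    (col_mx ph
       (Phi^T *m D *m Phi *m qh
        - kappab c *: (Phi^T *m hadamard (w ord0)
                                         (second_factor c (Phi *m qh) w))))
    (\mxcol_(i < k.+1) ((V i)^T *m aux_rate c (Phi *m qh) (Phi *m ph) w i)).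

End Reduction.

(* Main.v *)
(* Since Phi and the V_i have orthonormal columns, E_lift restricted to the
   reduced space is a quadratic form in the reduced variables:
     p^T p / 2 - q^T (Phi^T D Phi) q / 2 + w_1^T w_1 / kappa^2.
   Along the reduced flow the terms in D cancel by symmetry.  With s the factor
   such that f_non = kappab (w_1 . s), the equation of p contributes
     - kappab sum_a (V_1 w_1)_a s_a (Phi p)_a,
   and the equation of w_1 contributes the opposite; these trilinear sums agree
   because the Galerkin projection tests each Hadamard product against the same
   basis as the corresponding variable. *)
Require Import Defs.
From mathcomp Require Import all_boot all_order all_algebra.
From mathcomp Require Import all_classical all_reals all_analysis.
From mathcomp Require Import ring.
From mathcomp Require mpoly.
Import (canonicals, coercions) mpoly.

Set Implicit Arguments.
Unset Strict Implicit.
Unset Printing Implicit Defensive.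
Import Order.TTheory GRing.Theory Num.Theory.
Import numFieldNormedType.Exports.
Local Open Scope classical_set_scope.
Local Open Scope ring_scope.

(** * Degree bounds for polynomial functions *)

Section PolynomialDegree.
Variables (R : realType) (m : nat).
Implicit Types (d : nat) (f : 'cV[R]_m -> R).

(** A property of functions, not of polynomials: bounds then compose along the expression of a
    vector field without exhibiting its polynomials. The shift [d.+1] is that of [mmeasure], which
    is degree plus one. *)
Definition degree_le d f : Prop :=
  exists2 P : mpoly.mpoly m R,
    (mpoly.mmeasure (@mpoly.mdeg m) P <= d.+1)%N
    & forall x, f x = mpoly.meval (fun b => x b 0) P.

Lemma eq_degree_le d f f' : f =1 f' -> degree_le d f' -> degree_le d f.
Proof. by move=> ff' [P dP fP]; exists P => // x; rewrite ff'. Qed.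

Lemma degree_leW d d' f : (d <= d')%N -> degree_le d f -> degree_le d' f.
Proof. by move=> dd' [P dP fP]; exists P => //; exact: leq_trans dP _. Qed.

Lemma degree_le_cst d (a : R) : degree_le d (fun=> a).
Proof.
exists (mpoly.mpolyC m a) => [|x]; last by rewrite mpoly.mevalC.
by rewrite mpoly.mmeasureC; exact: leq_trans (leq_b1 _) _.
Qed.

Lemma degree_le_coord (b : 'I_m) : degree_le 1 (fun x => x b 0).
Proof.
exists (mpoly.mpolyX R (mpoly.mnm1 b)) => [|x]; last by rewrite mpoly.mevalXU.
by rewrite mpoly.mmeasureX /= mpoly.mdeg1.
Qed.

Lemma degree_leD d f f' :
  degree_le d f -> degree_le d f' -> degree_le d (fun x => f x + f' x).
Proof.
move=> [P dP fP] [P' dP' fP']; exists (P + P') => [|x].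
  by apply: leq_trans (mpoly.mmeasureD_le _ _ _) _; rewrite geq_max dP.
by rewrite mpoly.mevalD fP fP'.
Qed.

Lemma degree_leZ d (a : R) f : degree_le d f -> degree_le d (fun x => a * f x).
Proof.
move=> [P dP fP]; exists (a *: P) => [|x]; last by rewrite mpoly.mevalZ fP.
exact: leq_trans (mpoly.mmeasureZ_le _ _ _) dP.
Qed.

Lemma degree_le_sum d (I : Type) (s : seq I) (F : I -> 'cV[R]_m -> R) :
  (forall i, degree_le d (F i)) -> degree_le d (fun x => \sum_(i <- s) F i x).
Proof.
move=> dF; elim: s => [|i s IHs].
  by apply: eq_degree_le (degree_le_cst d 0) => x; rewrite big_nil.
apply: eq_degree_le (degree_leD (dF i) IHs) => x.
by rewrite big_cons.
Qed.

Lemma degree_leM d d' f f' : degree_le d f -> degree_le d' f' ->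
  degree_le (d + d') (fun x => f x * f' x).
Proof.
move=> [P dP fP] [P' dP' fP']; exists (P * P') => [|x].
  (* The measure of a product is the sum of the measures minus one only for nonzero factors, since
     zero has measure 0. *)
  have [->|P0] := eqVneq P 0; first by rewrite mul0r mpoly.mmeasure0.
  have [->|P'0] := eqVneq P' 0; first by rewrite mulr0 mpoly.mmeasure0.
  rewrite (mpoly.msizeM P0 P'0).
  by have := leq_add dP dP'; rewrite addSn addnS -!subn1 leq_subLR add1n.
by rewrite mpoly.mevalM fP fP'.
Qed.

End PolynomialDegree.

(** * Degree bounds for vector-valued maps *)

Section MapDegree.
Variables (R : realType) (m : nat).

Definition map_degree_le d l (F : 'cV[R]_m -> 'cV[R]_l) : Prop :=
  forall a, degree_le d (fun x => F x a 0).

Lemma quadratic_mapP l (F : 'cV[R]_m -> 'cV[R]_l) :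
  map_degree_le 2 F -> quadratic_map F.
Proof.
move=> dF.
(* Choice collects the polynomials found entry by entry into one family. *)
have /choice[P PF] a : exists P : mpoly.mpoly m R,
    (mpoly.mmeasure (@mpoly.mdeg m) P <= 3)%N /\
    forall x, F x a 0 = mpoly.meval (fun b => x b 0) P.
  by have [P dP FP] := dF a; exists P.
by exists P; split=> [a|x a]; [case: (PF a)|case: (PF a)].
Qed.

Lemma map_degree_leW d d' l (F : 'cV[R]_m -> 'cV[R]_l) :
  (d <= d')%N -> map_degree_le d F -> map_degree_le d' F.
Proof. by move=> dd' dF a; exact: degree_leW dd' (dF a). Qed.

Lemma map_degree_le_id : map_degree_le 1 (@id 'cV[R]_m).
Proof. by move=> a; exact: degree_le_coord. Qed.

Lemma map_degree_le_cst d l (v : 'cV[R]_l) : map_degree_le d (fun=> v).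
Proof. by move=> a; exact: degree_le_cst. Qed.

Lemma map_degree_leD d l (F G : 'cV[R]_m -> 'cV[R]_l) :
  map_degree_le d F -> map_degree_le d G ->
  map_degree_le d (fun x => F x + G x).
Proof.
move=> dF dG a; apply: eq_degree_le (degree_leD (dF a) (dG a)) => x.
by rewrite mxE.
Qed.

Lemma map_degree_leZ d l (k : R) (F : 'cV[R]_m -> 'cV[R]_l) :
  map_degree_le d F -> map_degree_le d (fun x => k *: F x).
Proof.
by move=> dF a; apply: eq_degree_le (degree_leZ k (dF a)) => x; rewrite mxE.
Qed.

Lemma map_degree_leN d l (F : 'cV[R]_m -> 'cV[R]_l) :
  map_degree_le d F -> map_degree_le d (fun x => - F x).
Proof.
move=> dF a; apply: eq_degree_le (degree_leZ (-1) (dF a)) => x.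
by rewrite mxE mulN1r.
Qed.

Lemma map_degree_le_sum d l (I : Type) (s : seq I)
    (F : I -> 'cV[R]_m -> 'cV[R]_l) :
  (forall i, map_degree_le d (F i)) ->
  map_degree_le d (fun x => \sum_(i <- s) F i x).
Proof.
move=> dF a; apply: eq_degree_le (degree_le_sum s (dF^~ a)) => x.
by rewrite summxE.
Qed.

Lemma map_degree_le_mulmx d l l' (A : 'M[R]_(l', l))
    (F : 'cV[R]_m -> 'cV[R]_l) :
  map_degree_le d F -> map_degree_le d (fun x => A *m F x).
Proof.
move=> dF a.
have dAF b : degree_le d (fun x => A a b * F x b 0) by exact: degree_leZ.
by apply: eq_degree_le (degree_le_sum _ dAF) => x; rewrite mxE.
Qed.

Lemma map_degree_le_hadamard d d' l (F G : 'cV[R]_m -> 'cV[R]_l) :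
  map_degree_le d F -> map_degree_le d' G ->
  map_degree_le (d + d') (fun x => hadamard (F x) (G x)).
Proof.
move=> dF dG a; apply: eq_degree_le (degree_leM (dF a) (dG a)) => x.
by rewrite mxE.
Qed.

Lemma map_degree_le_usubmx d l l' (F : 'cV[R]_m -> 'cV[R]_(l + l')) :
  map_degree_le d F -> map_degree_le d (fun x => usubmx (F x)).
Proof.
by move=> dF a; apply: eq_degree_le (dF (lshift l' a)) => x; rewrite mxE.
Qed.

Lemma map_degree_le_dsubmx d l l' (F : 'cV[R]_m -> 'cV[R]_(l + l')) :
  map_degree_le d F -> map_degree_le d (fun x => dsubmx (F x)).
Proof.
by move=> dF a; apply: eq_degree_le (dF (rshift l a)) => x; rewrite mxE.
Qed.

Lemma map_degree_le_col_mx d l l' (F : 'cV[R]_m -> 'cV[R]_l)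
    (G : 'cV[R]_m -> 'cV[R]_l') :
  map_degree_le d F -> map_degree_le d G ->
  map_degree_le d (fun x => col_mx (F x) (G x)).
Proof.
move=> dF dG a; rewrite -(fintype.splitK a); case: (fintype.split a) => b /=.
  by apply: eq_degree_le (dF b) => x; rewrite col_mxEu.
by apply: eq_degree_le (dG b) => x; rewrite col_mxEd.
Qed.

Lemma map_degree_le_submxcol d k (l : 'I_k -> nat)
    (F : 'cV[R]_m -> 'cV[R]_(\sum_i l i)) i :
  map_degree_le d F -> map_degree_le d (fun x => submxcol (F x) i).
Proof.
by move=> dF a; apply: eq_degree_le (dF (tagnat.Rank i a)) => x; rewrite mxE.
Qed.

Lemma map_degree_le_mxcol d k (l : 'I_k -> nat)
    (F : forall i, 'cV[R]_m -> 'cV[R]_(l i)) :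
  (forall i, map_degree_le d (F i)) ->
  map_degree_le d (fun x => \mxcol_i F i x).
Proof.
move=> dF a; apply: eq_degree_le (dF (tagnat.sig1 a) (tagnat.sig2 a)) => x.
by rewrite mxE.
Qed.

End MapDegree.

(** * Derivatives of matrix-valued functions *)

Section MatrixDerivative.
Context {R : realFieldType} {U : normedModType R}.

(** Derivability and the derivative are both entrywise for matrices, so each rule below follows from
    its scalar version. *)
Lemma is_derive_mxP m n (M : U -> 'M[R]_(m, n)) t v (dM : 'M[R]_(m, n)) :
  is_derive t v M dM <->
  forall i j, is_derive t v (fun x => M x i j) (dM i j).
Proof.
split=> [[dvM <-] i j|dvM].
  have dvMij := (derivable_mxP M t v).1 dvM i j.
  by split=> //; rewrite derive_mx// mxE.
have drM : derivable M t v by apply/derivable_mxP => i j; case: (dvM i j).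
split=> //; rewrite derive_mx//; apply/matrixP => i j; rewrite mxE.
by case: (dvM i j).
Qed.

Lemma is_derive_mulmx m n p (A : U -> 'M[R]_(m, n)) (B : U -> 'M[R]_(n, p))
    t v dA dB :
  is_derive t v A dA -> is_derive t v B dB ->
  is_derive t v (fun x => A x *m B x) (dA *m B t + A t *m dB).
Proof.
move=> /is_derive_mxP dAE /is_derive_mxP dBE; apply/is_derive_mxP => i j.
(* As a sum of products of scalar functions, the entry is differentiated by the scalar sum and
   product rules. *)
have -> : (fun x => (A x *m B x) i j)
    = \sum_(k < n) ((fun x => A x i k) * (fun x => B x k j)).
  by apply/funext => x; rewrite mxE fct_sumE.
apply: is_derive_eq; rewrite !mxE -big_split; apply: eq_bigr => k _ /=.
by rewrite addrC; congr (_ + _); exact: mulrC.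
Qed.

Lemma is_derive_trmx m n (A : U -> 'M[R]_(m, n)) t v dA :
  is_derive t v A dA -> is_derive t v (fun x => (A x)^T) dA^T.
Proof.
move=> /is_derive_mxP dAE; apply/is_derive_mxP => i j.
by under eq_fun do rewrite mxE; rewrite mxE.
Qed.

Lemma is_derive_usubmx m1 m2 n (A : U -> 'M[R]_(m1 + m2, n)) t v dA :
  is_derive t v A dA -> is_derive t v (fun x => usubmx (A x)) (usubmx dA).
Proof.
move=> /is_derive_mxP dAE; apply/is_derive_mxP => i j.
by under eq_fun do rewrite mxE; rewrite mxE.
Qed.

Lemma is_derive_dsubmx m1 m2 n (A : U -> 'M[R]_(m1 + m2, n)) t v dA :
  is_derive t v A dA -> is_derive t v (fun x => dsubmx (A x)) (dsubmx dA).
Proof.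
move=> /is_derive_mxP dAE; apply/is_derive_mxP => i j.
by under eq_fun do rewrite mxE; rewrite mxE.
Qed.

Lemma is_derive_submxcol k (m : 'I_k -> nat) n
    (A : U -> 'M[R]_(\sum_i m i, n)) t v dA i :
  is_derive t v A dA ->
  is_derive t v (fun x => submxcol (A x) i) (submxcol dA i).
Proof.
move=> /is_derive_mxP dAE; apply/is_derive_mxP => a b.
by under eq_fun do rewrite mxE; rewrite mxE.
Qed.

(** The product rule gives two terms; by symmetry of [A] each is the transpose of the other, and a 1
    x 1 matrix equals its transpose. *)
Lemma is_derive_quadratic_form n (A : 'M[R]_n) (u : U -> 'cV[R]_n) t v du :
  A^T = A -> is_derive t v u du ->
  is_derive t v (fun x => ((u x)^T *m A *m u x) 0 0)
    (2 * ((u t)^T *m A *m du) 0 0).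
Proof.
move=> symA dut.
have dtr := is_derive_trmx dut.
have := is_derive_mulmx (is_derive_mulmx dtr (is_derive_cst A t v)) dut.
move=> /is_derive_mxP/(_ 0 0); rewrite mulmx0 addr0 mxE.
suff -> : (du^T *m A *m u t) 0 0 = ((u t)^T *m A *m du) 0 0.
  by rewrite mulr2n mulrDl !mul1r.
transitivity (((u t)^T *m A *m du)^T 0 0); last by rewrite [LHS]mxE.
by rewrite !trmx_mul trmxK symA mulmxA.
Qed.

End MatrixDerivative.

(** * Orthonormal bases and Hadamard products *)

Lemma leading_left_singular_orthonormal (R : realType) n m r
    (S : 'M[R]_(n, m)) (V : 'M[R]_(n, r)) :
  leading_left_singular S V -> V^T *m V = 1%:M.
Proof.
move=> [le_rn [U [_ [_ [[UU _] _ _ _ ->]]]]].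
apply/matrixP => i j.
(* The Gram matrix of selected columns of [U] is a submatrix of that of [U], which is the
   identity. *)
transitivity ((U^T *m U) (widen_ord le_rn i) (widen_ord le_rn j)).
  by rewrite !mxE; apply: eq_bigr => a _; rewrite !mxE.
by rewrite UU !mxE.
Qed.

Lemma hadamardC (R : comNzRingType) m n (A B : 'M[R]_(m, n)) :
  hadamard A B = hadamard B A.
Proof. by apply/matrixP => i j; rewrite !mxE mulrC. Qed.

(** Both sides are the sum of x_a y_a z_a. This symmetry makes the two coupling terms of the energy
    balance comparable. *)
Lemma dot_hadamardCA (R : comNzRingType) n (x y z : 'cV[R]_n) :
  x^T *m hadamard y z = y^T *m hadamard x z.
Proof.
apply/matrixP => i j; rewrite !mxE; apply: eq_bigr => a _; rewrite !mxE.
by rewrite !ord1 mulrCA.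
Qed.

(** * The reduced system, its degree and its energy balance *)

Section Reduction.
Variables (R : realType) (n k r : nat) (rw : 'I_k.+1 -> nat).
Variables (D : 'M[R]_n) (c : coefs R k).
Variables (Phi : 'M[R]_(n, r)) (V : forall i, 'M[R]_(n, rw i)).

Lemma block_basis_mul (q p : 'cV[R]_r) (w : 'cV[R]_(\sum_i rw i)) :
  block_basis Phi V *m col_mx (col_mx q p) w
  = col_mx (col_mx (Phi *m q) (Phi *m p)) (\mxcol_i (V i *m submxcol w i)).
Proof.
rewrite /block_basis !mul_block_col !mul0mx !addr0 !add0r.
(* Split by columns, the product is a sum over j of block columns; in block row i only the term j =
   i survives. *)
congr (col_mx _ _); rewrite -[w in LHS]submxcolK mxblockEh mul_mxrow_mxcol.
under [LHS]eq_bigr do rewrite mxcol_mul.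
rewrite -mxcol_sum; apply/eq_mxcol => i.
rewrite (bigD1 i)//= eqxx big1 ?addr0// => j /negPf ij.
by rewrite eq_sym ij mul0mx.
Qed.

Lemma trmx_block_basis_mul (q p : 'cV[R]_n) (w : 'I_k.+1 -> 'cV[R]_n) :
  (block_basis Phi V)^T *m col_mx (col_mx q p) (\mxcol_i w i)
  = col_mx (col_mx (Phi^T *m q) (Phi^T *m p)) (\mxcol_i ((V i)^T *m w i)).
Proof.
rewrite /block_basis !tr_block_mx !trmx0 !mul_block_col !mul0mx !addr0 !add0r.
congr (col_mx _ _); rewrite tr_mxblock mxblockEh mul_mxrow_mxcol.
under [LHS]eq_bigr do rewrite mxcol_mul.
rewrite -mxcol_sum; apply/eq_mxcol => i.
rewrite (bigD1 i)//= eqxx big1 ?addr0// => j /negPf ji.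
by rewrite ji trmx0 mul0mx.
Qed.

(** Orthonormality of [Phi] turns the projected equation for q, whose right-hand side is Phi^T Phi
    p, into q' = p. The other blocks agree by associativity. *)
Lemma galerkin_lifted_fom : Phi^T *m Phi = 1%:M ->
  galerkin (block_basis Phi V) (lifted_fom D c) =1 rom D c Phi V.
Proof.
move=> PhiK z; rewrite /galerkin -[z in LHS]vsubmxK -[usubmx z in LHS]vsubmxK.
rewrite block_basis_mul /lifted_fom !(col_mxKu, col_mxKd) /=.
rewrite trmx_block_basis_mul /rom mulmxA PhiK mul1mx mulmxBr -scalemxAr !mulmxA.
(* [second_factor] and [aux_rate] take the whole family of auxiliary vectors, hence an equality of
   functions. *)
have -> : submxcol (\mxcol_i (V i *m submxcol (dsubmx z) i))
    = fun i => V i *m submxcol (dsubmx z) i.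
  by apply/funext => i; rewrite mxcolK.
by [].
Qed.

(** The right-hand side is built from affine maps, constant matrices and Hadamard products of two
    affine factors. *)
Lemma rom_quadratic : quadratic_map (rom D c Phi V).
Proof.
apply: quadratic_mapP; rewrite /rom /=.
have dq : map_degree_le 1 (fun z : 'cV[R]_(r + r + \sum_i rw i) =>
    usubmx (usubmx z)).
  by do 2!apply: map_degree_le_usubmx; exact: map_degree_le_id.
have dp : map_degree_le 1 (fun z : 'cV[R]_(r + r + \sum_i rw i) =>
    dsubmx (usubmx z)).
  apply: map_degree_le_dsubmx; apply: map_degree_le_usubmx.
  exact: map_degree_le_id.
have dw i : map_degree_le 1 (fun z : 'cV[R]_(r + r + \sum_i rw i) =>
    V i *m submxcol (dsubmx z) i).
  apply: map_degree_le_mulmx; apply: map_degree_le_submxcol.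
  by apply: map_degree_le_dsubmx; exact: map_degree_le_id.
have daff i : map_degree_le 1 (fun z : 'cV[R]_(r + r + \sum_i rw i) =>
    affine_term c i (Phi *m usubmx (usubmx z))
      (fun i => V i *m submxcol (dsubmx z) i)).
  apply: map_degree_leD.
    by apply: map_degree_leZ; exact: map_degree_le_mulmx.
  by apply: map_degree_le_sum => j; exact: map_degree_leZ.
have ds : map_degree_le 1 (fun z : 'cV[R]_(r + r + \sum_i rw i) =>
    second_factor c (Phi *m usubmx (usubmx z))
      (fun i => V i *m submxcol (dsubmx z) i)).
  rewrite /second_factor; case: insub => [i|]; first exact: dw.
  by apply: map_degree_leD; [exact: map_degree_le_cst|exact: daff].
apply: map_degree_le_col_mx; last first.
  apply: map_degree_le_mxcol => i; apply: map_degree_le_mulmx.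
  rewrite /aux_rate; case: (i == ord0).
    (* The bound 2 is read as 1 + 1, one for each affine factor. *)
    apply: map_degree_leZ; apply: (@map_degree_le_hadamard _ _ 1 1) => //.
    exact: map_degree_le_mulmx.
  apply: (@map_degree_le_hadamard _ _ 1 1) => //.
  exact: map_degree_le_mulmx.
apply: map_degree_le_col_mx; first exact: (@map_degree_leW _ _ 1).
apply: map_degree_leD.
  by apply: map_degree_le_mulmx; exact: (@map_degree_leW _ _ 1).
apply: map_degree_leN; apply: map_degree_leZ; apply: map_degree_le_mulmx.
exact: (@map_degree_le_hadamard _ _ 1 1).
Qed.

(** The identity matrices are kept so that all three terms have the shape u^T A u with A symmetric,
    ready for [is_derive_quadratic_form]. *)
Lemma lifted_energy_block_basis (z : 'cV[R]_(r + r + \sum_i rw i)) :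
  Phi^T *m Phi = 1%:M -> (forall i, (V i)^T *m V i = 1%:M) ->
  let q := usubmx (usubmx z) in
  let p := dsubmx (usubmx z) in
  let w1 := submxcol (dsubmx z) ord0 in
  lifted_energy D c (block_basis Phi V *m z)
  = (p^T *m 1%:M *m p) 0 0 / 2
    - (q^T *m (Phi^T *m D *m Phi) *m q) 0 0 / 2
    + (w1^T *m 1%:M *m w1) 0 0 / kappa c ^+ 2.
Proof.
move=> PhiK VK /=; rewrite -[z in LHS]vsubmxK -[usubmx z in LHS]vsubmxK.
rewrite block_basis_mul /lifted_energy !(col_mxKu, col_mxKd) mxcolK.
rewrite !trmx_mul !mulmxA !mulmx1.
rewrite -[_ *m Phi^T *m Phi]mulmxA PhiK mulmx1.
by rewrite -[_ *m (V _)^T *m V _]mulmxA VK mulmx1.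
Qed.

(** This is the derivative of the reduced energy along the flow. The factor 2 from differentiating a
    square cancels the halves in the p and q terms and remains in the [w1] term, where it meets the
    coefficient [kappa c ^+ 2 * kappab c / 2]. *)
Lemma rom_energy_rate (z : 'cV[R]_(r + r + \sum_i rw i)) :
  D^T = D -> kappa c != 0 ->
  let q := usubmx (usubmx z) in
  let p := dsubmx (usubmx z) in
  let w1 := submxcol (dsubmx z) ord0 in
  let dz := rom D c Phi V z in
  (p^T *m 1%:M *m dsubmx (usubmx dz)) 0 0
  - (q^T *m (Phi^T *m D *m Phi) *m usubmx (usubmx dz)) 0 0
  + 2 * (w1^T *m 1%:M *m submxcol (dsubmx dz) ord0) 0 0 / kappa c ^+ 2 = 0.
Proof.
move=> symD k0 /=.
rewrite /rom !(col_mxKu, col_mxKd) mxcolK /aux_rate eqxx !mulmx1.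
set q := usubmx (usubmx z); set p := dsubmx (usubmx z).
set w1 := submxcol (dsubmx z) ord0; set s := second_factor _ _ _.
rewrite mulmxBr -!scalemxAr.
(* A scalar equals its transpose, and [D] is symmetric: the two terms in [D] become identical. *)
have -> : p^T *m (Phi^T *m D *m Phi *m q) = q^T *m (Phi^T *m D *m Phi) *m p.
  apply/matrixP => i j; rewrite !ord1.
  transitivity ((p^T *m (Phi^T *m D *m Phi *m q))^T 0 0).
    by rewrite [RHS]mxE.
  by rewrite !trmx_mul !trmxK symD !mulmxA.
(* Both coupling terms are brought to the same scalar [b], the pairing of V_1 w_1 with the Hadamard
   product of Phi p and s; what is left is an identity in [b], using that [kappa c] is nonzero. *)
rewrite !mulmxA -!trmx_mul (dot_hadamardCA (Phi *m p)) (hadamardC s).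
set e := (Phi *m p); set b := _ *m hadamard e s.
rewrite ![in LHS]mxE; by field.
Qed.
End Reduction.

(** * Conservation of the lifted energy *)

Theorem theorem1 (R : realType) (n k : nat) (g : R -> R) (D : 'M[R]_n)
  (c : coefs R k) (w : 'I_k.+1 -> 'cV[R]_n -> 'cV[R]_n)
  (hg : smooth g) (hgnl : nonlinear g) (hD : D^T = D)
  (* Assumption 1 *)
  (hg0 : forall x, 0 <= g x)
  (* Steps 1-3 *)
  (hw : energy_variables g (derive1 g) c w)
  (* Assumption 2 *)
  (hquad : non_polynomial g ->
     quadratization (fom D (derive1 g)) (aux_vector w) (lifted_fom D c))
  (* Step 4 *)
  (K r : nat) (rw : 'I_k.+1 -> nat) (Q P : 'M[R]_(n, K))
  (Phi : 'M[R]_(n, r)) (V : forall i, 'M[R]_(n, rw i))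
  (hPhi : leading_left_singular (row_mx Q P) Phi)
  (hV : forall i, leading_left_singular (aux_snapshots (w i) Q) (V i)) :
  let Vb := block_basis Phi V in
  [/\ galerkin Vb (lifted_fom D c) =1 rom D c Phi V,
      quadratic_map (rom D c Phi V)
    & forall (J : set R) (z : R -> 'cV[R]_(r + r + \sum_i rw i)),
        open J -> solves (rom D c Phi V) J z ->
        forall t, J t ->
          is_derive t (1 : R) (fun s => lifted_energy D c (Vb *m z s)) 0].
Proof.
have PhiK := leading_left_singular_orthonormal hPhi.
have VK i := leading_left_singular_orthonormal (hV i).
have [k0 _ _ _ _] := hw.
move=> Vb; split; [exact: galerkin_lifted_fom|exact: rom_quadratic|].
move=> J z _ zsol t Jt; have dz := zsol t Jt.
have symPhiD : (Phi^T *m D *m Phi)^T = Phi^T *m D *m Phi.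
  by rewrite !trmx_mul trmxK hD mulmxA.
have dqp := is_derive_usubmx dz.
have dq := is_derive_quadratic_form symPhiD (is_derive_usubmx dqp).
have dp := is_derive_quadratic_form (trmx1 _ _) (is_derive_dsubmx dqp).
have dw := is_derive_quadratic_form (trmx1 _ _)
  (is_derive_submxcol ord0 (is_derive_dsubmx dz)).
under eq_fun do rewrite (lifted_energy_block_basis D c _ PhiK VK).
(* The target 0 is replaced by the energy rate at [z t], to be matched with what the derivation
   rules produce. *)
rewrite -[X in is_derive _ _ _ X](rom_energy_rate Phi V (z t) hD k0).
have dE := is_deriveD
  (is_deriveB (is_deriveZ 2^-1 dp) (is_deriveZ 2^-1 dq))
  (is_deriveZ (kappa c ^+ 2)^-1 dw).
move: dE; set f := (X in is_derive _ _ X _).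
set h := (X in _ -> is_derive _ _ X _).
(* The two functions differ only by writing division by 2 and by [kappa c ^+ 2] as scaling on the
   left. *)
have -> : f = h.
  by apply/funext => x; rewrite /f /h /= ![_ / _]mulrC.
move=> dE; apply: is_derive_eq dE _.
rewrite /GRing.scale /=.
by field.
Qed.
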